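(* Let $n,m\ge 2$ be integers and let $\mu$ be a joint distribution of $(X,A,Y)$ with $X\in\mathcal{X}\subseteq\mathbb{R}^d$, $A\in\{1,\dots,n\}$, $Y\in\{1,\dots,m\}$. For $i\in\{1,\dots,n\}$ let $\mu_i$ be the conditional distribution of $\mu$ given $A=i$, and let $p_i\in\Delta_m$ be the probability mass vector of $Y$ under $\mu_i$, i.e. $(p_i)_j=\Pr_{\mu_i}(Y=j)$ for $j\in\{1,\dots,m\}$. Let $h:\mathcal{X}\to\{1,\dots,m\}$ be a (measurable) predictor and $\widehat{Y}=h(X)$. If $\widehat{Y}$ satisfies demographic parity (i.e. $\widehat{Y}$ is independent of $A$), then $$\sum_{i=1}^n \mathrm{Err}_{\mu_i}(h)\;\ge\;\mathrm{OPT}(\{p_i\}_{i=1}^n).$$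
   Context: It is assumed that $\Pr(A=i)>0$ for every $i$. $\mathrm{Err}_{\mu_i}(h)=\Pr_{\mu_i}(Y\neq h(X))$. $\Delta_m=\{q\in\mathbb{R}^m: q_j\ge 0\ \forall j,\ \sum_{j=1}^m q_j=1\}$ is the probability simplex. $\mathrm{OPT}(\{p_i\}_{i=1}^n)$ is the optimal value of the TV-Barycenter problem: $$\mathrm{OPT}(\{p_i\}_{i=1}^n)=\min_{q\in\Delta_m}\ \frac12\sum_{i=1}^n\|q-p_i\|_1=\min_{q\in\Delta_m}\ \frac12\sum_{i=1}^n\sum_{j=1}^m|(p_i)_j-q_j|.$$ *)

(* Defs.v *)
From HB Require Import structures.
From mathcomp Require Import all_boot all_order all_algebra.
From mathcomp Require Import all_classical all_reals all_analysis.

Set Implicit Arguments.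
Unset Strict Implicit.
Unset Printing Implicit Defensive.

Import Order.TTheory GRing.Theory Num.Theory.
Import numFieldNormedType.Exports.

Local Open Scope classical_set_scope.
Local Open Scope ring_scope.

(* {1, ..., k} is rendered 0-based as 'I_k, with the discrete sigma-algebra.
   Measurable types are pointed, so the alias carries the proof of 2 <= k. *)
Definition label (k : nat) (k2 : (2 <= k)%N) : Type := 'I_k.

Section label.
Variables (k : nat) (k2 : (2 <= k)%N).

HB.instance Definition _ := Finite.copy (label k2) 'I_k.
HB.instance Definition _ := isPointed.Build (label k2) (Ordinal (ltnW k2)).
HB.instance Definition _ := @isMeasurable.Build default_measure_display
  (label k2) discrete_measurable discrete_measurable0
  discrete_measurableC discrete_measurableU.
End label.

(* The subset XX of R^d as a type, pointed by its nonemptiness (which the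
   existence of a probability measure on XX forces anyway). *)
Definition points (R : realType) (d : nat) (XX : set 'rV[R]_d)
  (XX0 : XX !=set0) : Type := {x : 'rV[R]_d | x \in XX}.

Section points.
Variables (R : realType) (d : nat) (XX : set 'rV[R]_d) (XX0 : XX !=set0).

HB.instance Definition _ := Choice.on (points XX0).
HB.instance Definition _ := isPointed.Build (points XX0)
  (exist _ (projT1 (cid XX0)) (mem_set (projT2 (cid XX0)))).

Definition feature_val (x : points XX0) : g_sigma_algebraType (@open 'rV[R]_d) :=
  sval x.

(* XX with the trace of the Borel sigma-algebra of R^d. *)
Definition feature := g_sigma_algebra_preimageType feature_val.
HB.instance Definition _ := Measurable.on feature.
End points.

Section prediction.
Variables (R : realType) (d n m : nat) (n2 : (2 <= n)%N) (m2 : (2 <= m)%N).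
Variables (XX : set 'rV[R]_d) (XX0 : XX !=set0).

(* The space of triples (x, a, y); varX, varA and varY are the random variables
   X, A and Y, so a joint law of (X, A, Y) is a probability on this space. *)
Definition triples : measurableType _ :=
  (feature XX0 * label n2 * label m2)%type.

Definition varX (w : triples) : feature XX0 := w.1.1.
Definition varA (w : triples) : label n2 := w.1.2.
Definition varY (w : triples) : label m2 := w.2.

Lemma measurable_group (i : 'I_n) : measurable [set w | varA w = i].
Proof.
have mA : measurable_fun setT varA.
  by apply: measurableT_comp => //; exact: measurable_snd.
have -> : [set w | varA w = i] = setT `&` varA @^-1` [set (i : label n2)].
  by rewrite setTI.
by apply: mA.
Qed.

(* mu_i, the law of mu conditioned on A = i. The second argument of mnormalize
   is only a default, used when mu (A = i) = 0. *)
Definition cond_law (mu : probability triples R) (i : 'I_n) :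
  probability triples R := mnormalize (mrestr mu (measurable_group i)) mu.

Definition Err (nu : probability triples R) (h : feature XX0 -> label m2) : R :=
  fine (nu [set w | varY w != h (varX w)]).

Definition pmfY (nu : probability triples R) : 'rV[R]_m :=
  \row_(j < m) fine (nu [set w | varY w = j]).
End prediction.

Definition independent_vars (d d1 d2 : measure_display) (T : measurableType d)
    (T1 : measurableType d1) (T2 : measurableType d2) (R : realType)
    (P : probability T R) (U : T -> T1) (V : T -> T2) : Prop :=
  forall (B : set T1) (C : set T2), measurable B -> measurable C ->
    P (U @^-1` B `&` V @^-1` C) = (P (U @^-1` B) * P (V @^-1` C))%E.

Definition demographic_parity (R : realType) (d n m : nat) (n2 : (2 <= n)%N)
    (m2 : (2 <= m)%N) (XX : set 'rV[R]_d) (XX0 : XX !=set0)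
    (mu : probability (triples n2 m2 XX0) R)
    (h : feature XX0 -> label m2) : Prop :=
  independent_vars mu (fun w => h (varX w)) (@varA R d n m n2 m2 XX XX0).

Section barycenter.
Variables (R : realType) (n m : nat).

Definition simplex : set 'rV[R]_m :=
  [set q | (forall j, 0 <= q 0 j) /\ \sum_(j < m) q 0 j = 1].

(* Not the library norm of 'rV[R]_m, which is the sup norm. *)
Definition l1norm (v : 'rV[R]_m) : R := \sum_(j < m) `|v 0 j|.

Definition tv_cost (p : 'I_n -> 'rV[R]_m) (q : 'rV[R]_m) : R :=
  2^-1 * \sum_(i < n) l1norm (q - p i).

(* The infimum is a minimum: see OPT_attained. *)
Definition OPT (p : 'I_n -> 'rV[R]_m) : R := inf (tv_cost p @` simplex).

Lemma OPT_attained (p : 'I_n -> 'rV[R]_m) : (0 < m)%N ->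
  exists q, [/\ simplex q, OPT p = tv_cost p q &
    forall q', simplex q' -> tv_cost p q <= tv_cost p q'].
Proof.
move=> m_gt0.
have S0 : simplex !=set0.
  exists (\row_j (j == Ordinal m_gt0)%:R); split=> [j|].
    by rewrite mxE ler0n.
  under eq_bigr do rewrite mxE.
  by rewrite (bigD1 (Ordinal m_gt0)) //= big1 ?addr0 ?eqxx // => j /negPf ->.
have csm k (f : 'I_k -> 'rV[R]_m -> R) : (forall i, continuous (f i)) ->
    continuous (fun q => \sum_(i < k) f i q).
  move=> cf; apply: continuous_big => //; exact: add_continuous.
have cS : compact simplex.
  have cbox := @rV_compact R m (fun=> `[0, 1]%classic)
    (fun=> @segment_compact R 0 1).
  have csum : closed [set q : 'rV[R]_m | \sum_(j < m) q 0 j = 1].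
    apply: (@preimage_closed _ _ (fun q : 'rV[R]_m => \sum_(j < m) q 0 j)
      [set 1]); last exact: closed_eq.
    move=> q _; move: q; apply: (csm _ (fun j q => q 0 j)) => j.
    exact: coord_continuous.
  rewrite (_ : simplex =
    [set v : 'rV[R]_m | forall i, `[0, 1]%classic (v ord0 i)]
      `&` [set q : 'rV[R]_m | \sum_(j < m) q 0 j = 1]).
    exact: compact_closedI.
  apply/seteqP; split=> q /= [q0 q1]; split=> // j.
    rewrite in_itv /= q0 -q1 (bigD1 j) //= lerDl.
    by apply: sumr_ge0.
  by have := q0 j; rewrite in_itv /= => /andP[].
have cf : {within simplex, continuous (tv_cost p)}.
  apply: continuous_subspaceT => q; apply: (@cvgM _ _ (nbhs q)); first exact: cvg_cst.
  move: q; apply: (csm _ (fun i q => l1norm (q - p i))) => i.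
  apply: (csm _ (fun j q => `|(q - p i) 0 j|)) => j.
  under eq_fun do rewrite !mxE.
  move=> q; apply: (@cvg_norm _ _ _ (nbhs q)).
  by apply: cvgB; [exact: coord_continuous|exact: cvg_cst].
have [q /set_mem qS qmin] := EVT_min_rV S0 cS cf.
have lbq : lbound (tv_cost p @` simplex) (tv_cost p q).
  by move=> _ [q' q'S <-]; apply: qmin; rewrite inE.
exists q; split=> // [|q' q'S]; last by apply: lbq; exists q'.
apply/eqP; rewrite eq_le; apply/andP; split.
  by apply: ge_inf; [exists (tv_cost p q)|exists q].
by apply: lb_le_inf => //; exists (tv_cost p q), q.
Qed.
End barycenter.

(* Main.v *)
(* Demographic parity makes the law q of h(X) the same under every mu_i, so q is
   a candidate barycenter, and OPT is at most its cost. Under mu_i, the pair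
   (h(X), Y) is a coupling of q and p_i, hence Pr(Y <> h(X)) bounds the total
   variation distance between them. *)
Require Import Defs.
From HB Require Import structures.
From mathcomp Require Import all_boot all_order all_algebra.
From mathcomp Require Import all_classical all_reals all_analysis.

Set Implicit Arguments.
Unset Strict Implicit.
Unset Printing Implicit Defensive.

Import Order.TTheory GRing.Theory Num.Theory.
Import numFieldNormedType.Exports.

Local Open Scope classical_set_scope.
Local Open Scope ring_scope.

Section coupling.
Context (d : measure_display) (T : measurableType d) (R : realType) (k : nat).
Variable P : probability T R.

(** The level sets of [U] cut [D] into finitely many disjoint measurable pieces, so additivity
    applies. It serves with [D] a disagreement event and with [D] the whole space. *)
Lemma sum_level_sets (U : T -> 'I_k) (D : set T) :
  (forall j, measurable [set w | U w = j]) -> measurable D ->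
  \sum_(j < k) fine (P ([set w | U w = j] `&` D)) = fine (P D).
Proof.
move=> mU mD.
have mUD j : measurable ([set w | U w = j] `&` D) by exact: measurableI.
rewrite sum_fine; last by move=> j _; exact: fin_num_measure.
rewrite -(@measure_bigsetU_ord _ _ _ P k predT
  (fun j => [set w | U w = j] `&` D)) //; last first.
  by move=> i j _ _ [w [[/= <- _] [/= <- _]]].
congr (fine (P _)); rewrite -bigcup_seq; apply/seteqP.
by split=> [w [j _ []]//|w Dw]; exists (U w); rewrite /= ?mem_index_enum.
Qed.

(* Off D = {V <> U} the level sets of U and V coincide, so only their parts
   inside D contribute, and these sum to P(D) for each of U and V. *)
Lemma l1_distance_le_neq (U V : T -> 'I_k) :
  (forall j, measurable [set w | U w = j]) ->
  (forall j, measurable [set w | V w = j]) ->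
  2^-1 * \sum_(j < k)
      `|fine (P [set w | U w = j]) - fine (P [set w | V w = j])|
    <= fine (P [set w | V w != U w]).
Proof.
move=> mU mV; set D := [set w | V w != U w].
have mD : measurable D.
  (* Agreement of [U] and [V] is a finite union of intersections of level sets, hence measurable. *)
  rewrite (_ : D = ~` \big[setU/set0]_(j < k)
    ([set w | U w = j] `&` [set w | V w = j])).
    apply: measurableC; apply: bigsetU_measurable => j _.
    exact: measurableI.
  rewrite -bigcup_seq; apply/seteqP; split=> w /=.
    by move=> /eqP VU [j _ [/= Uj Vj]]; apply: VU; rewrite Uj.
  by move=> nUV; apply/eqP => VU; apply: nUV; exists (U w); rewrite /= ?mem_index_enum.
have split_level (W : T -> 'I_k) j : measurable [set w | W w = j] ->
    fine (P [set w | W w = j]) = fine (P ([set w | W w = j] `\` D)) +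
      fine (P ([set w | W w = j] `&` D)).
  move=> mW; rewrite (measureDI P mW mD) fineD //; apply: fin_num_measure.
    exact: measurableD.
  exact: measurableI.
(* The factor 1/2 becomes a second copy of P(D) on the right; one copy is split along the levels of
   [U], the other along those of [V], which allows a termwise comparison. *)
rewrite mulrC ler_pdivrMr // mulr_natr mulr2n.
rewrite -{1}(sum_level_sets mU mD) -(sum_level_sets mV mD) -big_split /=.
apply: ler_sum => j _; rewrite (split_level U) // (split_level V) //.
have -> : [set w | U w = j] `\` D = [set w | V w = j] `\` D.
  by apply/seteqP; split=> w [/= <-] /negP; rewrite negbK => /eqP e;
    split=> //; rewrite /D /= e eqxx.
(* The parts off [D] cancel; what remains is |a - b| <= a + b for a, b >= 0. *)
rewrite opprD addrACA subrr add0r (le_trans (ler_normB _ _)) //.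
by rewrite !ger0_norm // fine_ge0.
Qed.
End coupling.

Section conditional_law.
Context (R : realType) (d n m : nat) (n2 : (2 <= n)%N) (m2 : (2 <= m)%N).
Context (XX : set 'rV[R]_d) (XX0 : XX !=set0).
Variable mu : probability (triples n2 m2 XX0) R.

(** Positive and finite mass of the group excludes the default branch of [mnormalize]. *)
Lemma cond_lawE (i : 'I_n) (B : set (triples n2 m2 XX0)) :
  (0 < mu [set w | varA w = i])%E ->
  cond_law mu i B = (mu (B `&` [set w | varA w = i])
    * ((fine (mu [set w | varA w = i]))^-1)%:E)%E.
Proof.
move=> mui; rewrite /cond_law /= /mnormalize /= /mrestr setTI gt_eqF //=.
rewrite lt_eqF //; apply: le_lt_trans (ltry 1).
by apply: probability_le1; exact: measurable_group.
Qed.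

Lemma measurable_prediction_level (h : feature XX0 -> label m2) (j : label m2) :
  measurable_fun setT h ->
  measurable [set w : triples n2 m2 XX0 | h (varX w) = j].
Proof.
move=> mh.
have mhX : measurable_fun setT (fun w : triples n2 m2 XX0 => h (varX w)).
  apply: measurableT_comp => //.
  by apply: measurableT_comp => //; exact: measurable_fst.
by have := mhX measurableT [set j] I; rewrite setTI.
Qed.

Lemma measurable_label_level (j : label m2) :
  measurable [set w : triples n2 m2 XX0 | varY w = j].
Proof.
have mY : measurable_fun setT (@varY R d n m n2 m2 XX XX0).
  exact: measurable_snd.
by have := mY measurableT [set j] I; rewrite setTI.
Qed.

(** Independence factors the joint probability, and the mass of the group cancels against the
    normalization. *)
Lemma cond_law_parity (h : feature XX0 -> label m2) (i : 'I_n) (j : label m2) :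
  (0 < mu [set w | varA w = i])%E -> demographic_parity mu h ->
  cond_law mu i [set w | h (varX w) = j] = mu [set w | h (varX w) = j].
Proof.
move=> mui dp; rewrite cond_lawE //.
have fA : mu [set w | varA w = i] \is a fin_num.
  by apply: fin_num_measure; exact: measurable_group.
(* In the discrete sigma-algebra measurability is [True], hence the proofs [I]. *)
have := dp [set j] [set (i : label n2)] I I; rewrite /preimage /= => ->.
rewrite -muleA -[X in (_ * (X * _))%E](fineK fA) -EFinM divff ?mule1 //.
by rewrite gt_eqF // fine_gt0 // mui ltey_eq fA.
Qed.
End conditional_law.

Theorem theorem12 (R : realType) (d n m : nat)
    (n2 : (2 <= n)%N) (m2 : (2 <= m)%N)
    (XX : set 'rV[R]_d) (XX0 : XX !=set0)
    (mu : probability (triples n2 m2 XX0) R)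
    (mu_group : forall i : 'I_n, (0 < mu [set w | varA w = i])%E)
    (h : feature XX0 -> label m2) (mh : measurable_fun setT h)
    (dp : demographic_parity mu h) :
  OPT (fun i : 'I_n => pmfY (cond_law mu i))
    <= \sum_(i < n) Err (cond_law mu i) h.
Proof.
pose q : 'rV[R]_m := \row_(j < m) fine (mu [set w | h (varX w) = j]).
have qS : simplex q.
  split=> [j|]; first by rewrite mxE fine_ge0.
  under eq_bigr do rewrite mxE -[X in mu X]setIT.
  rewrite (@sum_level_sets _ _ R m mu (fun w => h (varX w))) //.
    by rewrite probability_setT.
  by move=> j; exact: measurable_prediction_level.
have [q0 [_ -> qmin]] := OPT_attained (fun i => pmfY (cond_law mu i)) (ltnW m2).
apply: le_trans (qmin q qS) _; rewrite /tv_cost mulr_sumr.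
apply: ler_sum => i _.
(* Parity rewrites each entry of [q] as a probability under [cond_law mu i], so that both vectors
   are laws under one measure, as the coupling bound requires. *)
rewrite /l1norm; under eq_bigr => j _ do
  rewrite !mxE -(cond_law_parity j (mu_group i) dp).
apply: (@l1_distance_le_neq _ _ R m (cond_law mu i) (fun w => h (varX w))
  (@varY R d n m n2 m2 XX XX0)) => j.
  exact: measurable_prediction_level.
exact: measurable_label_level.
Qed.
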